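(* Let $\mathbf X=(X_t)_{t\ge 0}\in\mathcal G$ be a chain on $\{0,1\}^N$ with associated parameters $p$ and $q=1-p$, and associated independent random vectors $(Z_t)_{t\ge 1}$. Then for all $t\ge 1$ and all $x,y\in\{0,1\}^N$, $$P_t(y\mid x)=\pi(y,p)\left\{1+\sum_{A\subseteq[N],\,A\neq\emptyset}\left(\prod_{m=1}^t\rho_{A,m}\right)\left(\frac pq\right)^{|A|}\prod_{j\in A}\left(1-\frac{x[j]}{p}\right)\left(1-\frac{y[j]}{p}\right)\right\},$$ where $$\rho_{A,m}=\mathbb E\left[\prod_{j\in A}\left(1-\frac{Z_m[j]}{p}\right)\right].$$
   Context: Let $\mathcal V_N=\{0,1\}^N$ and $[N]=\{1,\dots,N\}$. For $y\in\mathcal V_N$ write $y=(y[1],\dots,y[N])$, $\|y\|=\sum_j y[j]$, and $y(B)=(y[j])_{j\in B}$ for $B\subseteq[N]$. For $p\in[1/2,1)$ put $q=1-p$ and $\pi(y,p)=p^{\|y\|}q^{N-\|y\|}$. The class $\mathcal G$ consists of the reversible Markov chains $\mathbf X=(X_t)_{t\ge0}$, not necessarily time-homogeneous, with state space $\mathcal V_N$ for some $N$, such that: (1) there is a parameter $p\ge 1/2$ such that $\pi(\cdot,p)$ is the unique stationary measure of $\mathbf X$ (reversibility is with respect to it; in the inhomogeneous case each one-step kernel is reversible with respect to it); (2) for all $t\ge1$, all $B\subseteq[N]$ and all $C\subseteq\{0,1\}^B$, $\mathbb P(X_t(B)\in C\mid X_{t-1})=\mathbb P(X_t(B)\in C\mid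 X_{t-1}(B))$, i.e. the conditional law of $X_t(B)$ given $X_{t-1}=x$ depends on $x$ only through $x(B)$. For $\mathbf X\in\mathcal G$, $(Z_t)_{t\ge1}$ is a sequence of independent random vectors in $\mathcal V_N$ with $\mathbb P(Z_t\in S)=\mathbb P(X_t\in S\mid X_{t-1}=\mathbf 0)$, $\mathbf 0=(0,\dots,0)$. $P_t(y\mid x)=\mathbb P(X_t=y\mid X_0=x)$. *)

(* Defs.v *)
From HB Require Import structures.
From mathcomp Require Import all_boot all_order all_algebra.
From mathcomp Require Import all_classical all_reals all_analysis.
Set Implicit Arguments.
Unset Strict Implicit.
Unset Printing Implicit Defensive.
Import Order.TTheory GRing.Theory Num.Theory.
Import numFieldNormedType.Exports.
Local Open Scope classical_set_scope.
Local Open Scope ring_scope.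

(* Coordinates are indexed by 'I_N, i.e. from 0, instead of by {1, ..., N}. *)
Definition cube (N : nat) : Type := {ffun 'I_N -> bool}.

Definition cube0 (N : nat) : cube N := [ffun=> false].

HB.instance Definition _ (N : nat) := Finite.on (cube N).
HB.instance Definition _ (N : nat) := isPointed.Build (cube N) (cube0 N).
HB.instance Definition _ (N : nat) := @isMeasurable.Build default_measure_display
  (cube N) discrete_measurable discrete_measurable0
  discrete_measurableC discrete_measurableU.

(* y(B), a function on the finite type of the elements of B *)
Definition restr (N : nat) (B : {set 'I_N}) (y : cube N) :
    {ffun {j : 'I_N | j \in B} -> bool} :=
  [ffun j => y (val j)].

Definition weight (N : nat) (y : cube N) : nat := \sum_(j < N) y j.

Definition pi_meas (R : realType) (N : nat) (p : R) (y : cube N) : R :=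
  p ^+ weight y * (1 - p) ^+ (N - weight y).

Section Chains.
Variables (R : realType) (N : nat).

Definition is_pmf (mu : cube N -> R) : Prop :=
  (forall x, 0 <= mu x) /\ \sum_(x : cube N) mu x = 1.

(* [K t x y] is the probability of the step from X_{t-1} = x to X_t = y, for
   t >= 1; the value [K 0] is never used.  The chain is time-homogeneous when
   [K t] does not depend on t. *)
Definition transitions := nat -> cube N -> cube N -> R.

Definition stationary (K : transitions) (mu : cube N -> R) : Prop :=
  is_pmf mu /\
  forall t, (1 <= t)%N -> forall y, \sum_(x : cube N) mu x * K t x y = mu y.

Record in_class_G (p : R) (K : transitions) : Prop := InClassG {
  G_param : 2^-1 <= p < 1;
  G_stochastic : forall t, (1 <= t)%N -> forall x, is_pmf (K t x);
  G_reversible : forall t, (1 <= t)%N -> forall x y,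
    pi_meas p x * K t x y = pi_meas p y * K t y x;
  G_stationary : stationary K (pi_meas p);
  G_unique : forall mu, stationary K mu -> mu =1 pi_meas p;
  (* the conditional law of X_t(B) given X_{t-1} = x depends on x only
     through x(B) *)
  G_local : forall t, (1 <= t)%N ->
    forall (B : {set 'I_N}) (C : {set {ffun {j : 'I_N | j \in B} -> bool}})
      (x x' : cube N), restr B x = restr B x' ->
    \sum_(y : cube N | restr B y \in C) K t x y =
    \sum_(y : cube N | restr B y \in C) K t x' y
}.

(* Under P, X is a Markov chain with transitions K started at x; the Markov
   property is multiplied out so as not to condition on null events. *)
Record markov_from (d : measure_display) (Omega : measurableType d)
    (K : transitions) (x : cube N) (P : probability Omega R)
    (X : nat -> {mfun Omega >-> cube N}) : Prop := MarkovFrom {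
  markov_start : P [set om | X 0%N om = x] = 1%E;
  markov_step : forall (t : nat) (w : nat -> cube N) (y : cube N),
    P [set om | (forall i, (i <= t)%N -> X i om = w i) /\ X t.+1 om = y] =
    (P [set om | forall i, (i <= t)%N -> X i om = w i] *
     (K t.+1 (w t) y)%:E)%E
}.

(* Mutual independence of the Z t, t >= 1. *)
Definition independent_from1 (d : measure_display) (Omega : measurableType d)
    (Q : probability Omega R) (Z : nat -> {RV Q >-> cube N}) : Prop :=
  forall (s : seq nat) (S : nat -> set (cube N)),
    uniq s -> (forall i, i \in s -> (1 <= i)%N) ->
    Q [set om | forall i, i \in s -> S i (Z i om)] =
    (\prod_(i <- s) Q [set om | S i (Z i om)])%E.

Record innovations (d : measure_display) (Omega : measurableType d)
    (K : transitions) (Q : probability Omega R)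
    (Z : nat -> {RV Q >-> cube N}) : Prop := Innovations {
  innov_indep : independent_from1 Z;
  innov_law : forall t, (1 <= t)%N -> forall S : {set cube N},
    Q [set om | Z t om \in S] = (\sum_(z in S) K t (cube0 N) z)%:E
}.

Definition rho (d : measure_display) (Omega : measurableType d)
    (Q : probability Omega R) (Z : nat -> {RV Q >-> cube N})
    (p : R) (A : {set 'I_N}) (m : nat) : R :=
  fine ('E_Q[(fun om => \prod_(j in A) (1 - (Z m om j)%:R / p))%R])%E.

End Chains.

(* Main.v *)
Require Import Defs.
From HB Require Import structures.
From mathcomp Require Import all_boot all_order all_algebra ring.
From mathcomp Require Import all_classical all_reals all_analysis.
Set Implicit Arguments.
Unset Strict Implicit.
Unset Printing Implicit Defensive.
Import Order.TTheory GRing.Theory Num.Theory.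
Local Open Scope classical_set_scope.
Local Open Scope ring_scope.

(** The products chi_A(x) = prod_(j in A) (1 - x[j]/p) are, up to scaling, an
    orthogonal basis of the functions on the cube for the product Bernoulli
    measure pi, and every kernel of the class is diagonal in that basis.

    Diagonality: let g = K_t chi_A.  Locality makes g a function of x(A) only,
    so g is orthogonal to chi_B whenever B is not contained in A
    ([chi_orthogonal]).  If A is not contained in B, reversibility rewrites
    <K_t chi_A, chi_B> as <chi_A, K_t chi_B>, and K_t chi_B is a function of
    x(B) only, so this vanishes for the same reason.  Hence g is orthogonal to
    every chi_B with B <> A ([step_chi_orthogonal]), and is a multiple of chi_A.
    As chi_A = 1 at the origin, the eigenvalue is g(0), which is the expectation
    of chi_A(Z_t), that is rho_(A,t) ([step_chi_eigen], [rho_step_chi]).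

    Conclusion: all the kernels share these eigenfunctions, so composing t steps
    multiplies eigenvalues even in the inhomogeneous case ([marginal_chi]):
    E_x chi_A(X_t) = (prod_(m <= t) rho_(A,m)) chi_A(x).  The completeness
    relation ([chi_complete])
      1_(x = y) = pi(y) sum_A (p/q)^|A| chi_A(x) chi_A(y),
    which is an expanded product over the coordinates, writes the indicator of
    X_t = y in terms of the chi_A(X_t); its expectation under P_x is the formula,
    the empty set contributing the summand 1. *)

(** * The orthogonal basis of the biased cube *)

Section Characters.
Context {R : realType} {N : nat} {p : R}.
Context (p_int : 2^-1 <= p < 1).
Implicit Types (A B : {set 'I_N}) (x y z : cube N).
Local Notation q := (1 - p).

Definition chi (r : R) A x : R := \prod_(j in A) (1 - (x j)%:R / r).

Let p_neq0 : p != 0.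
Proof.
have /andP[p_ge _] := p_int.
by apply: lt0r_neq0; apply: lt_le_trans p_ge; rewrite invr_gt0 ltr0n.
Qed.

Let q_neq0 : q != 0.
Proof. by have /andP[_ p_lt1] := p_int; rewrite subr_eq0 gt_eqF. Qed.

Lemma chi_cube0 A : chi p A (cube0 N) = 1.
Proof. by rewrite /chi big1 // => j _; rewrite ffunE mul0r subr0. Qed.

Lemma pi_meas_prod y : pi_meas p y = \prod_j (if y j then p else q).
Proof.
rewrite /pi_meas (bigID (fun j => y j)) /=.
rewrite (eq_bigr (fun=> p)) => [|j ->//].
rewrite [X in _ = _ * X](eq_bigr (fun=> q)) => [|j /negbTE->//].
rewrite !prodr_const.
have <- : weight y = #|[pred j | y j]|.
  rewrite /weight -sum1_card [RHS]big_mkcond /=.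
  by apply: eq_bigr => j _; rewrite inE; case: (y j).
have <- : (N - weight y)%N = #|[pred j | ~~ y j]|.
  rewrite /weight -[X in (X - _)%N]card_ord -sum1_card.
  rewrite -sumnB => [|j _]; last by case: (y j).
  rewrite -sum1_card [RHS]big_mkcond /=.
  by apply: eq_bigr => j _; rewrite inE; case: (y j).
by [].
Qed.

(** Coordinatewise, 1 + (p/q)(1 - a/p)(1 - b/p) is 1/q, 1/p or 0 according to
    whether the bits a and b are both 0, both 1 or different; expanding the
    product of these factors gives the sum over A.  This single identity is used
    in place of a dimension count to expand functions along the chi_A. *)
Lemma chi_complete x y :
  (x == y)%:R =
  pi_meas p y * \sum_(A : {set 'I_N}) (p / q) ^+ #|A| * (chi p A x * chi p A y).
Proof.
have -> : (x == y)%:R = \prod_j ((x j == y j)%:R : R).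
  have [->|/eqP neq_xy] := eqVneq x y.
    by rewrite big1 // => j _; rewrite eqxx.
  have [j neq_j] : exists j, x j != y j.
    by apply/existsP; apply: contra_notT neq_xy; rewrite negb_exists
      => /forallP eq_xy; apply/ffunP => j; apply/eqP; rewrite -[_ == _]negbK.
  by rewrite (bigD1 j) //= (negbTE neq_j) mul0r.
pose f j : R := p / q * ((1 - (x j)%:R / p) * (1 - (y j)%:R / p)).
have -> : \sum_(A : {set 'I_N}) (p / q) ^+ #|A| * (chi p A x * chi p A y)
    = \prod_j (f j + 1).
  rewrite (bigA_distr 1 +%R); apply: eq_big => [A|A _]; first by rewrite inE.
  by rewrite -big_mkcond /= /f big_split /= prodr_const big_split.
rewrite pi_meas_prod -big_split /=; apply: eq_bigr => j _.
rewrite /f; case: (x j); case: (y j) => /=; field; do ?[apply/andP; split] => //.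
Qed.

Definition flip (j : 'I_N) x : cube N := [ffun i => x i (+) (i == j)].

Lemma flipK j : involutive (flip j).
Proof. by move=> x; apply/ffunP => i; rewrite !ffunE -addbA addbb addbF. Qed.

Lemma flip_neq (i j : 'I_N) x : i != j -> flip j x i = x i.
Proof. by move=> /negbTE neq_ij; rewrite ffunE neq_ij addbF. Qed.

(** Flipping the bit j in B exchanges q * 1 and p * (1 - 1/p) = - q in the
    factor of pi * chi_B at j, so the summand changes sign and the sum, being
    its own opposite, vanishes. *)
Lemma chi_orthogonal B (j : 'I_N) (f : cube N -> R) :
    j \in B -> (forall x, f (flip j x) = f x) ->
  \sum_x pi_meas p x * (f x * chi p B x) = 0.
Proof.
move=> jB f_flip; set S := \sum_x _.
suff S_opp : S = - S.
  have : S *+ 2 == 0 by rewrite mulr2n {1}S_opp addNr.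
  by rewrite mulrn_eq0 /= => /eqP.
rewrite {1}/S (reindex_inj (inv_inj (flipK j))) /= -sumrN.
apply: eq_bigr => x _; rewrite f_flip.
rewrite !pi_meas_prod /chi !(bigD1 j jB) /= !(bigD1 (P := predT) j) //=.
under eq_bigr => i neq_ij do rewrite flip_neq //.
under [X in _ * (_ * (_ * X))]eq_bigr => i /andP[_ neq_ij] do rewrite flip_neq //.
by rewrite ffunE eqxx addbT; case: (x j) => /=; field.
Qed.

End Characters.

(** * The kernels of the class are diagonal in this basis *)

Section OneStep.
Context {R : realType} {N : nat} (p : R) (K : transitions R N).
Context (K_G : in_class_G p K).
Implicit Types (A B : {set 'I_N}) (x y z : cube N).

Let p_int : 2^-1 <= p < 1 := G_param K_G.

Definition step_chi t A x : R := \sum_y K t x y * chi p A y.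

(** Locality speaks of events about y(A).  As chi_A depends on y only through
    y(A), grouping the sum by the value of y(A) expresses it with the
    probabilities of the singleton events. *)
Lemma step_chi_local t A x x' : (1 <= t)%N ->
  restr A x = restr A x' -> step_chi t A x = step_chi t A x'.
Proof.
move=> t_ge1 eq_xx'.
(* chi_A as a function of y(A): for j in A, [insub] always succeeds. *)
pose g (r : {ffun {j : 'I_N | j \in A} -> bool}) : R :=
  \prod_(j in A) (1 - (if insub j is Some i then r i else false)%:R / p).
have chi_g y : chi p A y = g (restr A y).
  by apply: eq_bigr => j jA; rewrite insubT /= ffunE.
have by_restr u :
    step_chi t A u = \sum_r (\sum_(y | restr A y \in [set r]%SET) K t u y) * g r.
  rewrite /step_chi (partition_big (restr A) predT) //=; apply: eq_bigr => r _.
  rewrite mulr_suml; apply: eq_big => [y|y /eqP <-]; first by rewrite inE.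
  by rewrite chi_g.
rewrite !by_restr; apply: eq_bigr => r _; congr (_ * _).
exact: (G_local K_G).
Qed.

Lemma step_chi_selfadjoint t A B : (1 <= t)%N ->
  \sum_x pi_meas p x * (step_chi t A x * chi p B x) =
  \sum_x pi_meas p x * (step_chi t B x * chi p A x).
Proof.
move=> t_ge1.
have expand C D : \sum_x pi_meas p x * (step_chi t C x * chi p D x) =
    \sum_x \sum_y pi_meas p x * K t x y * (chi p C y * chi p D x).
  apply: eq_bigr => x _; rewrite mulr_suml mulr_sumr.
  by apply: eq_bigr => y _; ring.
rewrite !expand exchange_big /=; apply: eq_bigr => y _; apply: eq_bigr => x _.
by rewrite (G_reversible K_G) // [chi p A _ * _]mulrC.
Qed.

Lemma step_chi_flip t A (j : 'I_N) x : (1 <= t)%N -> j \notin A ->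
  step_chi t A (flip j x) = step_chi t A x.
Proof.
move=> t_ge1 jA; apply: step_chi_local => //; apply/ffunP => i; rewrite !ffunE.
suff /negbTE-> : val i != j by rewrite addbF.
by apply: contraNneq jA => <-; exact: valP i.
Qed.

Lemma step_chi_orthogonal t A B : (1 <= t)%N -> A != B ->
  \sum_x pi_meas p x * (step_chi t A x * chi p B x) = 0.
Proof.
move=> t_ge1; rewrite finset.eqEsubset negb_and => /orP[] /fintype.subsetPn[j].
  move=> jA jB; rewrite step_chi_selfadjoint //.
  by apply: (chi_orthogonal p_int jA) => x; exact: step_chi_flip.
by move=> jB jA; apply: (chi_orthogonal p_int jB) => x; exact: step_chi_flip.
Qed.

(** Expanding K_t chi_A along the chi_B by completeness leaves only the term
    B = A; evaluating at the origin, where chi_A is 1, identifies the factor. *)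
Lemma step_chi_eigen t A x : (1 <= t)%N ->
  step_chi t A x = step_chi t A (cube0 N) * chi p A x.
Proof.
move=> t_ge1.
suff [c c_eigen] : exists c, forall u, step_chi t A u = c * chi p A u.
  by rewrite !c_eigen chi_cube0 mulr1.
exists ((p / (1 - p)) ^+ #|A| *
        \sum_z pi_meas p z * (step_chi t A z * chi p A z)) => u.
have -> : step_chi t A u = \sum_z step_chi t A z * (u == z)%:R.
  rewrite (bigD1 u) //= eqxx mulr1 big1 ?addr0 // => z.
  by rewrite eq_sym => /negbTE->; rewrite mulr0.
under eq_bigr => z _ do rewrite (chi_complete p_int).
transitivity (\sum_(B : {set 'I_N}) (p / (1 - p)) ^+ #|B| * chi p B u *
    \sum_z pi_meas p z * (step_chi t A z * chi p B z)).
  under [RHS]eq_bigr => B _ do rewrite mulr_sumr.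
  rewrite exchange_big /=; apply: eq_bigr => z _.
  rewrite !mulr_sumr; apply: eq_bigr => B _.
  by move: (_ ^+ _) => r; ring.
rewrite (bigD1 A) //= [X in _ + X]big1 ?addr0 => [|B neq_BA].
  by rewrite mulrAC.
by rewrite step_chi_orthogonal ?mulr0 // eq_sym.
Qed.

End OneStep.

(** * Finite-valued random elements *)

Section FiniteValued.
Context {R : realType} {d : measure_display} {Omega : measurableType d}.
Context (P : probability Omega R).

Lemma prob_partition (T : finType) (E : set Omega) (f : Omega -> T) :
    measurable E -> (forall i, measurable [set om | f om = i]) ->
  fine (P E) = \sum_i fine (P (E `&` [set om | f om = i])).
Proof.
move=> mE mf.
have mEf i : measurable (E `&` [set om | f om = i]) by exact: measurableI.
have -> : P E = P (\bigcup_(i in [set: T]) (E `&` [set om | f om = i])).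
  congr (P _); rewrite -setI_bigcupr; apply/seteqP; split => [om Eom|om []//].
  by split=> //; exists (f om).
rewrite measure_fin_bigcup //.
- rewrite (_ : [set: T] = [set` index_enum T]); last first.
    by apply/seteqP; split => i //= _; rewrite mem_index_enum.
  rewrite -fsbig_seq ?index_enum_uniq // sum_fine // => i _.
  exact: fin_num_measure.
- exact: finite_finset.
by move=> i i' _ _ [om [[_ <-] [_ <-]]].
Qed.

Lemma expectation_finite {N : nat} (Z : {RV P >-> cube N}) (g : cube N -> R) :
  fine ('E_P[(fun om => g (Z om))])%E =
  \sum_z fine (P [set om | Z om = z]) * g z.
Proof.
have mZ z : measurable [set om | Z om = z].
  exact: (measurable_funPTI Z (Y := [set z])).
have -> : 'E_P[fun om => g (Z om)]%E =
    (\int[P]_om (\sum_z (g z)%:E * (\1_[set om | Z om = z] om)%:E))%E.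
  rewrite unlock; apply: eq_integral => om _.
  rewrite (bigD1 (Z om)) //= indicE mem_set // mule1.
  rewrite big1 ?adde0 // => z neq_z; rewrite indicE memNset ?mule0 //=.
  by move=> eq_z; rewrite eq_z eqxx in neq_z.
rewrite integral_sum //= => [|z]; last first.
  by apply: integrableZl => //; exact: integrable_indic.
rewrite -sum_fine => [|z _].
  apply: eq_bigr => z _; rewrite integralZl //; last exact: integrable_indic.
  rewrite integral_indic // setIT fineM //; last exact: fin_num_measure.
  by rewrite mulrC.
rewrite integralZl //; last exact: integrable_indic.
by rewrite integral_indic // setIT fin_numM // fin_num_measure.
Qed.

End FiniteValued.

(** * Time marginals of the chain *)

Section Marginals.
Context {R : realType} {N : nat} {K : transitions R N}.
Context {d : measure_display} {Omega : measurableType d}.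
Context (P : probability Omega R) (X : nat -> {mfun Omega >-> cube N}).
Context {x : cube N} (X_markov : markov_from K x P X).

Let measurable_path t (w : nat -> cube N) :
  measurable [set om | forall i, (i <= t)%N -> X i om = w i].
Proof.
have -> : [set om | forall i, (i <= t)%N -> X i om = w i] =
    \bigcap_(i in `I_t.+1) (X i @^-1` [set w i]).
  by apply/seteqP; split => om path_om i; [apply: path_om|apply: path_om].
apply: bigcap_measurable => [|i _]; first by exists 0%N.
exact: measurable_funPTI.
Qed.

Let measurable_value t y : measurable [set om | X t om = y].
Proof. exact: (measurable_funPTI (X t) (Y := [set y])). Qed.

Definition marginal t y : R := fine (P [set om | X t om = y]).

(** The Markov property is a statement on entire paths up to time t, so the
    Chapman-Kolmogorov step sums over the finitely many paths, grouped by their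
    last value. *)
Lemma marginalS t y : marginal t.+1 y = \sum_z marginal t z * K t.+1 z y.
Proof.
pose path om : {ffun 'I_t.+1 -> cube N} := [ffun i : 'I_t.+1 => X i om].
(* Only the values at i <= t matter, where [inord] is exact. *)
pose ext (w : {ffun 'I_t.+1 -> cube N}) i : cube N := w (inord i).
have pathE w : [set om | path om = w] =
    [set om | forall i, (i <= t)%N -> X i om = ext w i].
  apply/seteqP; split => om /= => [<- i le_it|path_om].
    by rewrite /ext ffunE inordK.
  by apply/ffunP => i; rewrite ffunE path_om ?/ext ?inord_val // -ltnS.
have mpath w : measurable [set om | path om = w] by rewrite pathE.
have ext_last w : ext w t = w ord_max.
  by congr (w _); apply/val_inj; rewrite /= inordK.
pose pr w := fine (P [set om | path om = w]).
have last_step w : fine (P ([set om | X t.+1 om = y] `&` [set om | path om = w]))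
    = pr w * K t.+1 (w ord_max) y.
  rewrite setIC pathE (markov_step X_markov) ext_last fineM //.
    by rewrite /pr pathE.
  exact: fin_num_measure.
rewrite /marginal (prob_partition P (measurable_value _ _) mpath).
under eq_bigr => w _ do rewrite last_step.
rewrite (partition_big (fun w : {ffun 'I_t.+1 -> cube N} => w ord_max) predT) //=.
apply: eq_bigr => z _.
rewrite (prob_partition P (measurable_value _ _) mpath) mulr_suml.
rewrite big_mkcond /=; apply: eq_bigr => w _.
have [w_last|neq_last] := eqVneq (w ord_max) z.
  rewrite w_last; congr (fine (P _) * _).
  apply/seteqP; split=> [om path_om|om []//].
  by split => //=; rewrite -w_last -path_om ffunE.
rewrite (_ : _ `&` _ = set0) ?measure0 ?mul0r //.
apply/seteqP; split => // om /= [X_om path_om].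
by move: neq_last; rewrite -path_om ffunE /= X_om eqxx.
Qed.

Lemma marginal0 y : marginal 0 y = (x == y)%:R.
Proof.
rewrite /marginal; have [<-|neq_xy] := eqVneq x y.
  by rewrite (markov_start X_markov).
have X0_as := markov_start X_markov.
have mX0 := measurable_value 0 x.
(* X_0 = y lies in the complement of the almost sure event X_0 = x. *)
apply/eqP; rewrite -[false%:R]/(0 : R) eq_le fine_ge0 ?measure_ge0 // andbT.
have -> : 0%R = fine (P (~` [set om | X 0%N om = x])) :> R.
  by rewrite probability_setC // X0_as subee.
rewrite fine_le ?fin_num_measure //; try exact: measurableC.
rewrite le_measure ?inE //; first exact: measurableC.
by move=> om /= ->; apply/nesym/eqP.
Qed.

Lemma marginal_chi {p : R} (K_G : in_class_G p K) t A :
  \sum_y marginal t y * chi p A y =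
  \prod_(1 <= m < t.+1) step_chi p K m A (cube0 N) * chi p A x.
Proof.
elim: t => [|t IHt].
  rewrite big_geq // mul1r (bigD1 x) //= marginal0 eqxx mul1r.
  rewrite big1 ?addr0 // => y.
  by rewrite marginal0 eq_sym => /negbTE->; rewrite mul0r.
rewrite big_nat_recr //= mulrAC -IHt mulr_suml.
under eq_bigr => y _ do rewrite marginalS mulr_suml.
rewrite exchange_big /=; apply: eq_bigr => z _.
rewrite -mulrA [chi p A z * _]mulrC -(step_chi_eigen K_G) // mulr_sumr.
by apply: eq_bigr => y _; rewrite mulrA.
Qed.

End Marginals.

(** * The spectral expansion of the transition probabilities *)

Lemma rho_step_chi (R : realType) (N : nat) (p : R) (K : transitions R N)
    (d : measure_display) (Omega : measurableType d)
    (Q : probability Omega R) (Z : nat -> {RV Q >-> cube N})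
    (hZ : innovations K Z) (A : {set 'I_N}) (m : nat) : (1 <= m)%N ->
  rho Z p A m = step_chi p K m A (cube0 N).
Proof.
move=> m_ge1; rewrite /rho (expectation_finite _ (chi p A)).
apply: eq_bigr => z _; congr (_ * _).
have := innov_law hZ m_ge1 [set z]%SET; rewrite big_set1 => law_z.
rewrite -[RHS]/(fine (K m (cube0 N) z)%:E) -law_z.
congr (fine (Q _)); apply/seteqP.
by split => om /=; rewrite finset.in_set1 => /eqP.
Qed.

Theorem theorem3p3 (R : realType) (N : nat) (p : R) (K : transitions R N)
    (hK : in_class_G p K)
    (d : measure_display) (Omega : measurableType d)
    (P : cube N -> probability Omega R) (X : nat -> {mfun Omega >-> cube N})
    (hX : forall x : cube N, markov_from K x (P x) X)
    (d' : measure_display) (Omega' : measurableType d')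
    (Q : probability Omega' R) (Z : nat -> {RV Q >-> cube N})
    (hZ : innovations K Z)
    (t : nat) (ht : (1 <= t)%N) (x y : cube N) :
  P x [set om | X t om = y] =
  (pi_meas p y *
   (1 + \sum_(A : {set 'I_N} | A != finset.set0)
          (\prod_(1 <= m < t.+1) rho Z p A m) * (p / (1 - p)) ^+ #|A| *
          \prod_(j in A) ((1 - (x j)%:R / p) * (1 - (y j)%:R / p))))%:E.
Proof.
have mXy : measurable [set om | X t om = y].
  exact: (measurable_funPTI (X t) (Y := [set y])).
rewrite -[LHS]fineK ?fin_num_measure //; congr (_%:E).
have p_int := G_param hK.
have rho0 m : rho Z p finset.set0 m = 1.
  rewrite /rho (_ : (fun om => _) = cst 1) ?expectation_cst //.
  by apply/funext => om; rewrite big_set0.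
(* The probability of X_t = y as the expectation of an indicator. *)
transitivity (\sum_z marginal (P x) X t z * (z == y)%:R).
  rewrite (bigD1 y) //= eqxx mulr1 big1 ?addr0 // => z /negbTE->.
  by rewrite mulr0.
under eq_bigr => z _ do rewrite (chi_complete p_int).
transitivity (pi_meas p y * \sum_(A : {set 'I_N})
    (\prod_(1 <= m < t.+1) rho Z p A m) * (p / (1 - p)) ^+ #|A| * (chi p A x * chi p A y)).
  under eq_bigr => z _ do rewrite !mulr_sumr.
  rewrite exchange_big mulr_sumr /=; apply: eq_bigr => A _.
  rewrite (eq_big_nat _ _ (F2 := fun m => step_chi p K m A (cube0 N))); last first.
    by move=> m /andP[m_ge1 _]; exact: rho_step_chi.
  have chi_t := marginal_chi (hX x) hK t A.
  transitivity (pi_meas p y * (p / (1 - p)) ^+ #|A| * chi p A y *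
      \sum_z marginal (P x) X t z * chi p A z).
    by rewrite mulr_sumr; apply: eq_bigr => z _; move: (_ ^+ _) => r; ring.
  by rewrite chi_t; move: (_ ^+ _) => r; ring.
congr (_ * _); rewrite (bigD1 finset.set0) //=; congr (_ + _).
  by rewrite big1 // cards0 /chi !big_set0 !mulr1.
by apply: eq_bigr => A _; rewrite /chi big_split.
Qed.
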